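(* Let $A$ be a general metric space. (a) $WFil^*(A)$ has the colimits of all (small) functors with non-empty domain. (b) The family of forward Cauchy sequences is dense in $WFil^*(A)$. (c) The flat filters on $A$ are exactly the colimits in $WFil^*(A)$ of functors with non-empty filtered domain taking values in forward Cauchy sequences.
   Context: A general metric space is a set $A$ with $A(-,-):A\times A\to[0,\infty]$ such that $A(x,x)=0$ and $A(y,z)+A(x,y)\ge A(x,z)$ for all $x,y,z$. Filters on $A$ are proper (all members non-empty). A filter $\mathcal{F}$ on $A$ is weakly flat if for every $\epsilon>0$ there is $f\in\mathcal{F}$ such that for all $x\in f$ and all $g\in\mathcal{F}$ there is $y\in g$ with $A(x,y)\le\epsilon$. It is flat if for every $\epsilon>0$ there is $f\in\mathcal{F}$ such that for every finite family $(x_i)_{i \in I}$ in $f$ and every $g\in\mathcal{F}$ there is $y\in g$ with $A(x_i,y)\le\epsilon$ for all $i$. For weakly flat filters, $\mathcal{F}_1\to\mathcal{F}_2$ means: for all $\epsilon>0$ there is $f\in\mathcal{F}_1$ such that for all $x\in f$ and all $g\in\mathcal{F}_2$ there is $y\in g$ with $A(x,y)\le\epsilon$. $WFil^*(A)$ is the preorder (viewed as a category) of weakly flat filters on $A$ with this relation $\to$. A sequence $(x_n)_{n\in\mathbb{N}}$ in $A$ is forward Cauchy if for all $\epsilon>0$ there is $N$ such that $A(x_n,x_m)\le\epsilon$ for all $m\ge n\ge N$. A sequence is identified with the filter having basis the sets $\{x_p\mid p\ge n\}$, $n\in\mathbb{N}$; the filter of a forward Cauchy sequence is flat, hence an object of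 $WFil^*(A)$. A family of objects is dense if the full subcategory on it is dense; in a preorder this means that every object is a least upper bound of the members of the family below it. *)

(* Defs.v *)
From HB Require Import structures.
From mathcomp Require Import all_boot all_order all_algebra.
From mathcomp Require Import boolp classical_sets filter reals constructive_ereal.

Set Implicit Arguments.
Unset Strict Implicit.
Unset Printing Implicit Defensive.

Import Order.TTheory GRing.Theory Num.Theory.
Local Open Scope classical_set_scope.
Local Open Scope ring_scope.
Local Open Scope ereal_scope.

Record category := Category {
  object :> Type;
  hom : object -> object -> Type;
  idm : forall a, hom a a;
  compm : forall a b c, hom b c -> hom a b -> hom a c;
  comp1m : forall a b (f : hom a b), compm (idm b) f = f;
  compm1 : forall a b (f : hom a b), compm f (idm a) = f;
  compmA : forall a b c d (f : hom a b) (g : hom b c) (h : hom c d),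
    compm h (compm g f) = compm (compm h g) f
}.
Arguments idm {_} _.
Arguments compm {_ _ _ _} _ _.

Record functor (J C : category) := Functor {
  fobj :> J -> C;
  fmor : forall i j, hom i j -> hom (fobj i) (fobj j);
  fmor1 : forall i, fmor (idm i) = idm (fobj i);
  fmorM : forall i j k (u : hom i j) (v : hom j k),
    fmor (compm v u) = compm (fmor v) (fmor u)
}.
Arguments fmor {_ _} _ {_ _} _.

Record cocone (J C : category) (D : functor J C) := Cocone {
  vertex : C;
  leg : forall j, hom (D j) vertex;
  leg_nat : forall i j (u : hom i j), compm (leg j) (fmor D u) = leg i
}.
Arguments vertex {_ _ _} _.
Arguments leg {_ _ _} _ _.

Definition is_colimit (J C : category) (D : functor J C) (c : cocone D) : Prop :=
  forall c' : cocone D, exists! m : hom (vertex c) (vertex c'),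
    forall j, compm m (leg c j) = leg c' j.

(* Non-emptiness is kept as a separate hypothesis. *)
Definition filtered (J : category) : Prop :=
  (forall i j : J, exists k : J, inhabited (hom i k) /\ inhabited (hom j k)) /\
  (forall (i j : J) (u v : hom i j),
     exists (k : J) (w : hom j k), compm w u = compm w v).

Record preorder := Preorder {
  pre_carrier :> Type;
  pre : pre_carrier -> pre_carrier -> Prop;
  pre_refl : forall x, pre x x;
  pre_trans : forall x y z, pre x y -> pre y z -> pre x z
}.

Program Definition category_of_preorder (P : preorder) : category :=
  {| object := P;
     hom := @pre P;
     idm := @pre_refl P;
     compm := fun a b c v u => @pre_trans P a b c u v |}.
Next Obligation. by move=> *; exact: Prop_irrelevance. Qed.
Next Obligation. by move=> *; exact: Prop_irrelevance. Qed.
Next Obligation. by move=> *; exact: Prop_irrelevance. Qed.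
Coercion category_of_preorder : preorder >-> category.

Definition is_least_upper_bound (P : preorder) (S : set P) (x : P) : Prop :=
  (forall y, S y -> pre y x) /\
  (forall z, (forall y, S y -> pre y z) -> pre x z).

Definition dense_family (P : preorder) (I : Type) (K : I -> P) : Prop :=
  forall x : P, is_least_upper_bound [set y | range K y /\ pre y x] x.

Record general_metric (R : realType) := GeneralMetric {
  gm_carrier :> Type;
  gdist : gm_carrier -> gm_carrier -> \bar R;
  gdist_ge0 : forall x y, 0 <= gdist x y;
  gdistxx : forall x, gdist x x = 0;
  gdist_triangle : forall x y z, gdist x z <= gdist y z + gdist x y
}.

Section Filters.
Variables (R : realType) (A : general_metric R).
Implicit Types F G : set_system A.

Definition weakly_flat F : Prop :=
  forall e : R, (0 < e)%R -> exists2 f, F f &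
    forall x g, f x -> F g -> exists2 y, g y & gdist x y <= e%:E.

Definition flat F : Prop :=
  forall e : R, (0 < e)%R -> exists2 f, F f &
    forall (I : finType) (x : I -> A) g, (forall i, f (x i)) -> F g ->
      exists2 y, g y & forall i, gdist (x i) y <= e%:E.

Definition filter_to F G : Prop :=
  forall e : R, (0 < e)%R -> exists2 f, F f &
    forall x g, f x -> G g -> exists2 y, g y & gdist x y <= e%:E.

Definition forward_cauchy (x : nat -> A) : Prop :=
  forall e : R, (0 < e)%R -> exists N, forall n m,
    (N <= n)%N -> (n <= m)%N -> gdist (x n) (x m) <= e%:E.

Definition seq_filter (x : nat -> A) : set_system A :=
  filter_from [set: nat] (fun n => x @` [set p | (n <= p)%N]).

Lemma flat_weakly_flat F : flat F -> weakly_flat F.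
Proof.
move=> Ff e e0; have [f Hf Hx] := Ff e e0; exists f => // x g fx Fg.
have [y gy Hy] := Hx unit (fun=> x) g (fun=> fx) Fg.
by exists y => //; exact: Hy tt.
Qed.

Lemma seq_filter_proper x : ProperFilter (seq_filter x).
Proof.
apply: filter_from_proper; last by move=> n _; exists (x n), n => /=.
apply: filter_from_filter; first by exists 0%N.
move=> i j _ _; exists (maxn i j) => // _ [p /= Hp <-].
by move: Hp; rewrite geq_max => /andP[ip jp]; split; exists p.
Qed.

Lemma forward_cauchy_flat x : forward_cauchy x -> flat (seq_filter x).
Proof.
move=> xC e e0; have [N HN] := xC e e0.
exists (x @` [set p | (N <= p)%N]); first by exists N.
move=> I z g Hz [n _ ng].
have {Hz} /choice[p Hp] : forall i, exists p, (N <= p)%N /\ x p = z i.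
  by move=> i; have [p Np xp] := Hz i; exists p.
exists (x (maxn n (\max_(i : I) p i))).
  by apply: ng; exists (maxn n (\max_(i : I) p i)) => //=; exact: leq_maxl.
move=> i; have [Np <-] := Hp i; apply: HN => //.
by rewrite leq_max [X in _ || X](leq_bigmax i) orbT.
Qed.

Lemma filter_to_trans F1 F2 F3 :
  filter_to F1 F2 -> filter_to F2 F3 -> filter_to F1 F3.
Proof.
move=> F12 F23 e e0; have e20 : (0 < e / 2)%R by rewrite divr_gt0.
have [f1 Ff1 H1] := F12 _ e20; have [f2 Ff2 H2] := F23 _ e20.
exists f1 => // x g f1x Fg; have [y f2y xy] := H1 x f2 f1x Ff2.
have [z gz yz] := H2 y g f2y Fg; exists z => //.
apply: le_trans (gdist_triangle x y z) _.
by rewrite [e in e%:E]splitr EFinD leeD.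
Qed.

Record weakly_flat_filter := WeaklyFlatFilter {
  wff_filter :> set_system A;
  wff_proper : ProperFilter wff_filter;
  wff_weakly_flat : weakly_flat wff_filter
}.

(* Weak flatness of F is, verbatim, the relation F -> F. *)
Definition WFil : preorder :=
  {| pre_carrier := weakly_flat_filter;
     pre := fun F1 F2 : weakly_flat_filter => filter_to F1 F2;
     pre_refl := wff_weakly_flat;
     pre_trans := fun F1 F2 F3 : weakly_flat_filter => @filter_to_trans F1 F2 F3 |}.

Record forward_cauchy_seq := ForwardCauchySeq {
  fcs_seq :> nat -> A;
  fcs_cauchy : forward_cauchy fcs_seq
}.

Definition fcs_filter (x : forward_cauchy_seq) : WFil :=
  WeaklyFlatFilter (seq_filter_proper x)
    (flat_weakly_flat (forward_cauchy_flat (fcs_cauchy x))).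

End Filters.

(* Main.v *)
(** Write [near_set F e] for the set of points from which every member of [F]
    is met within distance [e]; then [F -> G] says that every [near_set G e]
    belongs to [F].  Hence the intersection of a non-empty family of weakly flat
    filters is its least upper bound.

    Density: from any point of [near_set F e] one can build, with geometrically
    decreasing steps, a forward Cauchy sequence [s -> F] staying within [2e] of
    that point.  If every such [s] is below [H], then [near_set F (e/4)] is
    contained in [near_set H e], so [F -> H].

    A filtered intersection of flat filters is flat because finitely many points
    can be moved into one filter of the family, and flatness is invariant under
    isomorphism.  Conversely, if [F] is flat then the forward Cauchy sequences
    below [F] are directed: an upper bound of [x] and [y] is obtained by the
    geometric construction, its [n+1]-st term being chosen close to the [n]-th
    one and to far away terms of [x] and of [y]. *)
Require Import Defs.
From HB Require Import structures.
From mathcomp Require Import all_boot all_order all_algebra.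
From mathcomp Require Import boolp classical_sets filter reals constructive_ereal.
From mathcomp Require Import lra.

Set Implicit Arguments.
Unset Strict Implicit.
Unset Printing Implicit Defensive.

Import Order.TTheory GRing.Theory Num.Theory.
Local Open Scope classical_set_scope.
Local Open Scope ring_scope.
Local Open Scope ereal_scope.

(** * Colimits in a preorder as least upper bounds *)

Lemma preorder_hom_eq (P : preorder) (x y : P) (u v : @Defs.hom P x y) : u = v.
Proof. exact: (@Prop_irrelevance (pre x y)). Qed.

(** Morphisms are proofs of a proposition, so naturality of the legs and uniqueness of the mediating
    morphism are automatic. *)
Lemma colimit_of_lub (P : preorder) (J : category) (D : functor J P) (v : P) :
  is_least_upper_bound (range (fobj D)) v ->
  exists2 c : cocone D, vertex c = v & is_colimit c.
Proof.
move=> [ub lub].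
have vleg j : pre (fobj D j) v by apply: ub; exists j.
exists (@Cocone J P D v vleg (fun i j u => preorder_hom_eq _ _)) => // c'.
have m : pre v (vertex c') by apply: lub => _ [j _ <-]; exact: leg c' j.
exists m; split=> [j|m' _]; exact: preorder_hom_eq.
Qed.

Lemma lub_of_colimit (P : preorder) (J : category) (D : functor J P)
    (c : cocone D) :
  is_colimit c -> is_least_upper_bound (range (fobj D)) (vertex c).
Proof.
move=> colim; split=> [_ [j _ <-]|z ub]; first exact: leg c j.
have zleg j : pre (fobj D j) z by apply: ub; exists j.
have [m _] := colim (@Cocone J P D z zleg (fun i j u => preorder_hom_eq _ _)).
exact: m.
Qed.

Lemma lub_unique (P : preorder) (S : set P) (x y : P) :
  is_least_upper_bound S x -> is_least_upper_bound S y -> pre x y /\ pre y x.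
Proof. by move=> [ubx lubx] [uby luby]; split; [exact: lubx|exact: luby]. Qed.

(** The full subcategory on the family [k], with [T] as its type of objects; it serves as the domain
    of the diagram in (c). *)
Definition subpreorder (P : preorder) (T : Type) (k : T -> P) : preorder :=
  {| pre_carrier := T;
     pre := fun a b => pre (k a) (k b);
     pre_refl := fun a => pre_refl (k a);
     pre_trans := fun a b c => @pre_trans P (k a) (k b) (k c) |}.

Definition subpreorder_functor (P : preorder) (T : Type) (k : T -> P) :
    functor (subpreorder k) P :=
  @Functor (subpreorder k) P k (fun i j u => u)
    (fun i => preorder_hom_eq _ _) (fun i j k u v => preorder_hom_eq _ _).

Lemma directed_filtered (P : preorder) :
  (forall x y : P, exists z, pre x z /\ pre y z) -> filtered P.
Proof.
move=> dir; split=> [x y|x y u v].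
  by have [z [xz yz]] := dir x y; exists z; split; constructor.
by exists y, (pre_refl y); exact: preorder_hom_eq.
Qed.

(** Induction on the enumeration of [I]; [inhabited J] settles the empty family. *)
Lemma filtered_finite_bound (J : category) (I : finType) (j : I -> J) :
  inhabited J -> filtered J -> exists k : J, forall i, inhabited (Defs.hom (j i) k).
Proof.
move=> [j0] [dir _].
suff [k Hk] : exists k : J, forall i, i \in enum I -> inhabited (Defs.hom (j i) k).
  by exists k => i; apply: Hk; rewrite mem_enum.
elim: (enum I) => [|a s [k Hk]]; first by exists j0.
have [l [[al] [kl]]] := dir (j a) k; exists l => i; rewrite inE.
move=> /orP[/eqP -> //|/Hk[ik]]; constructor; exact: compm kl ik.
Qed.

Lemma dependent_choice_nat (T : Type) (P : nat -> T -> Prop)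
    (Q : nat -> T -> T -> Prop) (x0 : T) :
  P 0%N x0 ->
  (forall n x, P n x -> exists y, P n.+1 y /\ Q n x y) ->
  exists s : nat -> T, [/\ s 0%N = x0, forall n, P n (s n) &
    forall n, Q n (s n) (s n.+1)].
Proof.
move=> P0 step.
(* [choice] wants a total successor: where [P] fails, [a.2] is a dummy value about which nothing is
   claimed. *)
have step' (a : nat * T) : exists y, P a.1 a.2 -> P a.1.+1 y /\ Q a.1 a.2 y.
  have [/step[y ?]|nP] := pselect (P a.1 a.2); first by exists y.
  by exists a.2.
have [nxt Hnxt] := choice step'.
pose s := fix s n := if n is m.+1 then nxt (m, s m) else x0.
have Ps n : P n (s n) by elim: n => //= n /(Hnxt (n, s n))[].
by exists s; split=> // n; have [] := Hnxt (n, s n) (Ps n).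
Qed.

(** * Near sets and the relation between filters *)

Section Filters.
Variables (R : realType) (A : general_metric R).
Implicit Types (F G H : set_system A) (x s : nat -> A).

Definition near_set F (e : R) : set A :=
  [set a | forall g, F g -> exists2 y, g y & gdist a y <= e%:E].

Lemma filter_toP F G : Filter F ->
  filter_to F G <-> forall e : R, (0 < e)%R -> F (near_set G e).
Proof.
move=> FF; split=> [FG e /FG[f Ff fG]|FG e e0].
  by apply: filterS Ff => a fa g; exact: fG.
by exists (near_set G e); [exact: FG|move=> a g; apply].
Qed.

Lemma gdist_triangle_le (a b c : A) (d e r : R) :
  gdist a b <= d%:E -> gdist b c <= e%:E -> (d + e <= r)%R ->
  gdist a c <= r%:E.
Proof.
move=> ab bc der; apply: le_trans (gdist_triangle a b c) _.
apply: (@le_trans _ _ (e%:E + d%:E)); first exact: leeD.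
by rewrite -EFinD lee_fin addrC.
Qed.

Lemma near_set_le F (d e : R) : (d <= e)%R -> near_set F d `<=` near_set F e.
Proof.
move=> de a aF g /aF[y gy ay]; exists y => //.
by apply: le_trans ay _; rewrite lee_fin.
Qed.

Lemma near_set_sub F G (e : R) : F `<=` G -> near_set G e `<=` near_set F e.
Proof. by move=> FG a aG g /FG; exact: aG. Qed.

Lemma near_set_dist F (a b : A) (d e r : R) :
  gdist a b <= d%:E -> near_set F e b -> (d + e <= r)%R -> near_set F r a.
Proof.
move=> ab bF der g /bF[y gy bY]; exists y => //.
exact: gdist_triangle_le ab bY der.
Qed.

(** The slack [e - d] pays for the passage to [G]: [near_set G (e - d)] belongs to [F], hence is met
    within [d] of [a]. *)
Lemma near_set_to F G (a : A) (d e : R) : Filter F ->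
  filter_to F G -> near_set F d a -> (d < e)%R -> near_set G e a.
Proof.
move=> FF /filter_toP FG aF de.
have [|b bG ab] := aF (near_set G (e - d)%R).
  by apply: FG; rewrite subr_gt0.
by apply: near_set_dist ab bG _; rewrite addrC subrK.
Qed.

(** Three moves of length [e / 3]: from each [x i] into the flatness witness [f] of [F], from there
    to a common [z] near [G], and from [z] into [g]. *)
Lemma flat_iso F G : Filter F -> Filter G ->
  filter_to F G -> filter_to G F -> flat F -> flat G.
Proof.
move=> FF FG /filter_toP FtoG /filter_toP GtoF flatF e e0.
have e30 : (0 < e / 3)%R by rewrite divr_gt0.
have [f Ff Hf] := flatF _ e30.
exists (near_set F (e / 3)%R) => [|I x g xF Gg]; first exact: GtoF.
have /choice[y Hy] : forall i, exists y, f y /\ gdist (x i) y <= (e / 3)%:E.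
  by move=> i; have [y] := xF i f Ff; exists y.
have [||z zG yz] := Hf I y (near_set G (e / 3)%R).
- by move=> i; have [] := Hy i.
- exact: FtoG.
have [w gw zw] := zG g Gg; exists w => // i; have [_ xy] := Hy i.
apply: (gdist_triangle_le xy (gdist_triangle_le (yz i) zw (lexx _))); lra.
Qed.

Lemma seq_filter_near x N (S : set A) :
  (forall p, (N <= p)%N -> S (x p)) -> seq_filter x S.
Proof. by move=> Sx; exists N => // _ [p /= Np <-]; exact: Sx. Qed.

Lemma near_set_seq s (a : A) (e : R) N :
  (forall m, (N <= m)%N -> gdist a (s m) <= e%:E) ->
  near_set (seq_filter s) e a.
Proof.
move=> as_ g [n _ sg]; exists (s (maxn N n)); last first.
  by apply: as_; exact: leq_maxl.
by apply: sg; exists (maxn N n) => //=; exact: leq_maxr.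
Qed.

(** * Forward Cauchy sequences built with geometric steps *)

Definition geometric (e : R) (n : nat) : R := (e / 2 ^+ n)%R.

Lemma geometric_gt0 (e : R) n : (0 < e)%R -> (0 < geometric e n)%R.
Proof. by move=> e0; rewrite divr_gt0// exprn_gt0. Qed.

Lemma geometricS (e : R) n :
  (geometric e n.+1 + geometric e n.+1 = geometric e n)%R.
Proof. by rewrite /geometric exprSr invfM mulrA -splitr. Qed.

Lemma geometric_le (e : R) n m :
  (0 < e)%R -> (n <= m)%N -> (geometric e m <= geometric e n)%R.
Proof.
move=> e0 nm; rewrite ler_pM2l// lef_pV2 ?posrE ?exprn_gt0//.
by rewrite ler_eXn2l ?ltr1n.
Qed.

Lemma geometric_lt (e d : R) : (0 < d)%R -> exists N, (geometric e N < d)%R.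
Proof.
move=> d0; exists (Num.bound (e / d)).
rewrite /geometric ltr_pdivrMr ?exprn_gt0// mulrC -ltr_pdivrMr//.
(* [Num.bound (e / d)] is an exponent [N] with [e / d < 2 ^+ N]. *)
exact: upper_nthrootP (leqnn _).
Qed.

(** Twice the [n]-th step bounds all remaining steps together: after the first one, twice the next
    step is again [geometric e n]. *)
Lemma geometric_steps (e : R) s :
  (forall n, gdist (s n) (s n.+1) <= (geometric e n)%:E) -> (0 < e)%R ->
  forall n m, (n <= m)%N ->
    gdist (s n) (s m) <= (geometric e n + geometric e n)%:E.
Proof.
move=> step e0 n m /subnKC <-; move: (m - n)%N => k; elim: k n => [|k IH] n.
  by rewrite addn0 gdistxx lee_fin addr_ge0// ltW// geometric_gt0.
rewrite addnS -addSn.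
apply: gdist_triangle_le (step n) (IH n.+1) _.
by rewrite geometricS.
Qed.

Lemma geometric_steps_cauchy (e : R) s : (0 < e)%R ->
  (forall n, gdist (s n) (s n.+1) <= (geometric e n)%:E) -> forward_cauchy s.
Proof.
move=> e0 step d d0.
have [|N eN] := @geometric_lt e (d / 2)%R; first by rewrite divr_gt0.
exists N => n m Nn nm; apply: le_trans (geometric_steps step e0 nm) _.
rewrite lee_fin; have := geometric_le e0 Nn; lra.
Qed.

Lemma geometric_near_to F (e : R) s : (0 < e)%R ->
  (forall n, near_set F (geometric e n) (s n)) -> filter_to (seq_filter s) F.
Proof.
move=> e0 sF; apply/(filter_toP _ (seq_filter_proper s)) => d d0.
have [N eN] := geometric_lt e d0.
apply: (seq_filter_near (N := N)) => p Np; apply: near_set_le (sF p).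
exact: le_trans (geometric_le e0 Np) (ltW eN).
Qed.

Lemma forward_cauchy_from F (a : A) (e : R) : Filter F -> weakly_flat F ->
  (0 < e)%R -> near_set F e a ->
  exists s : forward_cauchy_seq A, filter_to (seq_filter s) F /\
    forall n, gdist a (s n) <= (e + e)%:E.
Proof.
move=> FF /filter_toP Fw e0 aF.
have [|n b bF|s [s0 sF step]] := dependent_choice_nat
  (P := fun n b => near_set F (geometric e n) b)
  (Q := fun n b c => gdist b c <= (geometric e n)%:E) (x0 := a).
- by rewrite /geometric expr0 divr1.
(* Weak flatness puts [near_set F (geometric e n.+1)] in [F], so the invariant on [b] yields a point
   of it within [geometric e n]. *)
- have [c cF bc] := bF _ (Fw _ (geometric_gt0 n.+1 e0)).
  by exists c.
exists (ForwardCauchySeq (geometric_steps_cauchy e0 step)); split=> /= [|n].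
  exact: geometric_near_to sF.
rewrite -s0; apply: le_trans (geometric_steps step e0 (leq0n n)) _.
by rewrite /geometric expr0 divr1.
Qed.

Lemma fcs_dense : dense_family (@fcs_filter R A).
Proof.
move=> F; split=> [_ []//|H ub]; have FF := wff_proper F.
apply/filter_toP => e e0; have e40 : (0 < e / 4)%R by rewrite divr_gt0.
have /filter_toP Fw := wff_weakly_flat F.
apply: filterS (Fw _ e40) => a aF.
have [s [sF as_]] := forward_cauchy_from FF (@wff_weakly_flat _ _ F) e40 aF.
have sH : filter_to (seq_filter s) H.
  by apply: (ub (fcs_filter s)); split=> //; exists s.
have sP := seq_filter_proper s.
(* All [s m] are within [e / 4 + e / 4] of [a]; being strictly below [e], this leaves slack for
   passing to [H]. *)
apply: (near_set_to _ sH (near_set_seq (N := 0%N) (fun m _ => as_ m))); lra.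
Qed.

Lemma fcs_directed F (x y : forward_cauchy_seq A) : ProperFilter F -> flat F ->
  filter_to (seq_filter x) F -> filter_to (seq_filter y) F ->
  exists z : forward_cauchy_seq A, [/\ filter_to (seq_filter z) F,
    filter_to (seq_filter x) (seq_filter z) &
    filter_to (seq_filter y) (seq_filter z)].
Proof.
move=> FF Fflat xF yF.
pose eps := geometric 1%R.
have eps0 n : (0 < eps n)%R by exact: geometric_gt0.
have /choice[f Hf] : forall n, exists f, F f /\
    forall (I : finType) (x : I -> A) g, (forall i, f (x i)) -> F g ->
      exists2 y, g y & forall i, gdist (x i) y <= (eps n)%:E.
  by move=> n; have [f Ff ?] := Fflat _ (eps0 n); exists f.
(* A term of index at least [n] from which the [n]-th flatness witness [f n] is reached within
   [eps n]. *)
have late (u : forward_cauchy_seq A) : filter_to (seq_filter u) F ->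
    exists p : nat -> nat, forall n, (n <= p n)%N /\
      exists2 b, f n b & gdist (u (p n)) b <= (eps n)%:E.
  move=> uF; suff /choice[p Hp] : forall n, exists q, (n <= q)%N /\
      exists2 b, f n b & gdist (u q) b <= (eps n)%:E by exists p.
  move=> n; have [S [N _ NS] Hu] := uF _ (eps0 n); exists (maxn n N).
  split; first exact: leq_maxl.
  apply: Hu; last by have [] := Hf n.
  by apply: NS; exists (maxn n N) => //=; exact: leq_maxr.
have [p Hp] := late x xF; have [q Hq] := late y yF.
have [z0 f0] := filter_ex (proj1 (Hf 0%N)).
have [n b fb|z [_ zf Hz]] := dependent_choice_nat (P := f)
  (Q := fun n b c => [/\ gdist b c <= (eps n)%:E,
     gdist (x (p n)) c <= (eps n + eps n)%:E &
     gdist (y (q n)) c <= (eps n + eps n)%:E]) f0.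
  have [_ [u fu xu]] := Hp n; have [_ [v fv yv]] := Hq n.
  have [_ Hn] := Hf n.
  (* Flatness for the triple [b], [u], [v] in [f n] gives one point of [f n.+1] that continues [z]
     and stays close to both sequences. *)
  have [||c fc Hc] := Hn 'I_3 (fun i => nth b [:: b; u; v] i) (f n.+1).
  - by move=> [[|[|[|]]]].
  - by have [] := Hf n.+1.
  exists c; split=> //; split; first exact: Hc ord0.
  - exact: gdist_triangle_le xu (Hc (Ordinal (isT : (1 < 3)%N))) (lexx _).
  - exact: gdist_triangle_le yv (Hc (Ordinal (isT : (2 < 3)%N))) (lexx _).
have step n : gdist (z n) (z n.+1) <= (eps n)%:E by have [] := Hz n.
have below (u : forward_cauchy_seq A) (r : nat -> nat) :
    (forall n, (n <= r n)%N) ->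
    (forall n, gdist (u (r n)) (z n.+1) <= (eps n + eps n)%:E) ->
    filter_to (seq_filter u) (seq_filter z).
  move=> nr uz; apply/(filter_toP _ (seq_filter_proper u)) => e e0.
  have e40 : (0 < e / 4)%R by rewrite divr_gt0.
  have [N HN] := fcs_cauchy u e40.
  have [M HM] := geometric_lt 1%R e40.
  apply: (seq_filter_near (N := N)) => k Nk.
  (* The successor skips [z 0], about which [uz] is silent. From [u k] to [u (r m)] costs [e / 4],
     and on to [z m.+1] less than [e / 2]. *)
  apply: (near_set_seq (N := (maxn k M).+1)) => -[//|m].
  rewrite ltnS geq_max => /andP[km Mm].
  apply: gdist_triangle_le (HN _ _ Nk (leq_trans km (nr m))) (uz m) _.
  have : (eps m < e / 4)%R := le_lt_trans (geometric_le ltr01 Mm) HM.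
  lra.
exists (ForwardCauchySeq (geometric_steps_cauchy ltr01 step)); split=> /=.
- apply: (geometric_near_to ltr01) => n g Fg.
  have [_ Hn] := Hf n.
  have [c gc Hc] := Hn unit (fun=> z n) g (fun=> zf n) Fg.
  by exists c => //; exact: Hc tt.
- by apply: (below x p) => n; [have [] := Hp n|have [] := Hz n].
- by apply: (below y q) => n; [have [] := Hq n|have [] := Hz n].
Qed.

(** * Intersections of families of weakly flat filters *)

Section Intersection.
Variables (T : Type) (D : T -> weakly_flat_filter A).

Definition meet_filter : set_system A := [set f | forall j, wff_filter (D j) f].

(** The empty intersection would contain the empty set; this is where non-emptiness of the domain
    enters (a). *)
Lemma meet_filter_proper : inhabited T -> ProperFilter meet_filter.
Proof.
move=> [j0]; split=> [/(_ j0)|].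
  by have := wff_proper (D j0) => ?; exact: filter_not_empty.
split=> [j|f g Df Dg j|f g fg Df j]; have := wff_proper (D j) => ?.
- exact: filterT.
- exact: filterI.
- exact: filterS (Df j).
Qed.

Lemma meet_filter_ub j : filter_to (D j) meet_filter.
Proof.
have := wff_proper (D j) => ?.
apply/filter_toP => e e0; have /filter_toP Dw := wff_weakly_flat (D j).
by apply: filterS (Dw _ e0); apply: near_set_sub => f; exact.
Qed.

Lemma meet_filter_lub H :
  (forall j, filter_to (D j) H) -> filter_to meet_filter H.
Proof.
move=> DH e e0; exists (near_set H e) => [j|a g aH]; last exact: aH.
have := wff_proper (D j) => ?.
by have /filter_toP := DH j; exact.
Qed.

Lemma meet_is_lub : inhabited T -> exists2 G : WFil A,
  wff_filter G = meet_filter & is_least_upper_bound (range (D : T -> WFil A)) G.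
Proof.
(* Weak flatness is the relation of the intersection to itself, so it follows from the two bound
   properties with [H] the intersection. *)
move=> T0; have Gw : weakly_flat meet_filter.
  by apply: meet_filter_lub => j; exact: meet_filter_ub.
exists (WeaklyFlatFilter (meet_filter_proper T0) Gw) => //; split.
  by move=> _ [j _ <-]; exact: meet_filter_ub.
by move=> H ub; apply: meet_filter_lub => j; apply: ub; exists j.
Qed.

Lemma meet_flat : inhabited T -> (forall j, flat (D j)) ->
  (forall (I : finType) (j : I -> T),
    exists k, forall i, filter_to (D (j i)) (D k)) ->
  flat meet_filter.
Proof.
move=> T0 Dflat dir e e0; have e40 : (0 < e / 4)%R by rewrite divr_gt0.
(* The union contains a member of each [D j], so it lies in the intersection, while each of its
   points is near a single [D j]. *)
exists (\bigcup_j near_set (D j) (e / 4)%R) => [j|I x g xD Gg].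
  have := wff_proper (D j) => ?; have /filter_toP Dw := wff_weakly_flat (D j).
  by apply: filterS (Dw _ e40) => a aD; exists j.
have /choice[j Hj] : forall i, exists j, near_set (D j) (e / 4)%R (x i).
  by move=> i; have [j] := xD i; exists j.
have [k Hk] := dir I j; have [f Df Hf] := Dflat k _ e40.
have /choice[y Hy] : forall i, exists y, f y /\ gdist (x i) y <= (e / 2)%:E.
  move=> i; have := wff_proper (D (j i)) => ?.
  have [|y fy xy] := near_set_to (e := (e / 2)%R) _ (Hk i) (Hj i) _ Df.
    lra.
  by exists y.
have [z gz yz] := Hf I y g (fun i => proj1 (Hy i)) (Gg k).
exists z => // i; apply: gdist_triangle_le (proj2 (Hy i)) (yz i) _; lra.
Qed.

End Intersection.
End Filters.

Theorem theorem3p35 (R : realType) (A : general_metric R) :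
  (* (a) *)
  (forall (J : category) (D : functor J (WFil A)), inhabited J ->
     exists c : cocone D, is_colimit c) /\
  (* (b) *)
  dense_family (@fcs_filter R A) /\
  (* (c) *)
  (forall F : set_system A, ProperFilter F ->
     (flat F <->
      exists (J : category) (D : functor J (WFil A)) (c : cocone D),
        [/\ inhabited J, filtered J,
            (forall j : J, exists x : forward_cauchy_seq A, D j = fcs_filter x),
            is_colimit c &
            wff_filter (vertex c) = F])).
Proof.
split=> [J D J0|].
  have [G _ /colimit_of_lub[c _ ?]] := meet_is_lub (fobj D) J0.
  by exists c.
split; first exact: fcs_dense.
move=> F FF; split=> [Fflat|[J [D [c [J0 Jfilt Dfcs colim <-]]]]].
  pose F' : WFil A := WeaklyFlatFilter FF (flat_weakly_flat Fflat).
  (* The diagram of all forward Cauchy sequences below [F]; density makes [F] its least upper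
     bound. *)
  pose k (t : {x : forward_cauchy_seq A | filter_to (seq_filter x) F}) : WFil A :=
    fcs_filter (sval t).
  have lub : is_least_upper_bound (range (fobj (subpreorder_functor k))) F'.
    have [_ F'lub] := fcs_dense F'; split=> [_ [[x xF] _ <-]//|H ub].
    by apply: F'lub => _ [[x _ <-] xF]; apply: ub; exists (exist _ x xF).
  have [c cF colim] := colimit_of_lub lub.
  exists (subpreorder k), (subpreorder_functor k), c; split=> //.
  - have /filter_toP Fw := flat_weakly_flat Fflat.
    have [a aF] := filter_ex (Fw _ ltr01).
    have [x [xF _]] :=
      forward_cauchy_from FF (flat_weakly_flat Fflat) ltr01 aF.
    by constructor; exists x.
  - apply: directed_filtered => -[x xF] [y yF].
    have [z [zF xz yz]] := fcs_directed FF Fflat xF yF.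
    by exists (exist _ z zF).
  - by move=> [x xF]; exists x.
  - by rewrite cF.
have [G Gmeet Glub] := meet_is_lub (fobj D) J0.
(* The given colimit is determined only up to isomorphism, so flatness is proved for the
   intersection and then transported. *)
have [GV VG] := lub_unique Glub (lub_of_colimit colim).
have := wff_proper G => ?; have := wff_proper (vertex c) => ?.
apply: (flat_iso _ _ GV VG); rewrite Gmeet; apply: meet_flat => // [j|I j].
  by have [x ->] := Dfcs j; exact/forward_cauchy_flat/fcs_cauchy.
have [l Hl] := filtered_finite_bound j J0 Jfilt.
by exists l => i; have [u] := Hl i; exact: (@fmor _ _ D _ _ u).
Qed.
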